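(* For any connected graph $G$, $\gamma_{1/2}(G)\leq \lceil \gamma(G)/2\rceil$.
   Context: All graphs are finite and simple. For a graph $G=(V,E)$ and $v\in V$, $N[v]=\{v\}\cup\{u : uv\in E\}$, and for $S\subseteq V$, $N[S]=\bigcup_{u\in S}N[u]$. A set $S$ is dominating if $N[S]=V$, and $\gamma(G)$ is the minimum cardinality of a dominating set. For $p\in[0,1]$, a set $S\subseteq V$ is a $p$-dominating set if $|N[S]|/|V|\geq p$; $\gamma_p(G)$ is the minimum cardinality of a $p$-dominating set of $G$. *)

(* Defs.v *)
From mathcomp Require Import all_boot all_order all_algebra.

Set Implicit Arguments.
Unset Strict Implicit.
Unset Printing Implicit Defensive.

(* A graph is given by its finite vertex type V and its adjacency relation e;
   it is simple when e is symmetric and irreflexive. *)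
Definition simple_graph (V : finType) (e : rel V) : Prop :=
  symmetric e /\ irreflexive e.

(* The graph on the empty vertex set does not count as connected: the ratio
   |N[S]| / |V| is undefined there. *)
Definition connected_graph (V : finType) (e : rel V) : Prop :=
  0 < #|V| /\ forall u v : V, connect e u v.

Definition closed_nbhd (V : finType) (e : rel V) (v : V) : {set V} :=
  v |: [set u | e v u].

Definition closed_nbhd_set (V : finType) (e : rel V) (S : {set V}) : {set V} :=
  \bigcup_(u in S) closed_nbhd e u.

Definition dominating (V : finType) (e : rel V) (S : {set V}) : bool :=
  closed_nbhd_set e S == [set: V].

Definition domination_number (V : finType) (e : rel V) : nat :=
  #|[arg min_(S < [set: V] | dominating e S) #|S| ]|.

Definition p_dominating (R : realFieldType) (p : R) (V : finType) (e : rel V)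
    (S : {set V}) : bool :=
  (p <= #|closed_nbhd_set e S|%:R / #|V|%:R)%R.

(* [set: V], the default in the arg min, is p-dominating whenever p <= 1 and V
   is nonempty, so this is then the minimum cardinality of a p-dominating set. *)
Definition partial_domination_number (R : realFieldType) (p : R)
    (V : finType) (e : rel V) : nat :=
  #|[arg min_(S < [set: V] | p_dominating p e S) #|S| ]|.

(* Main.v *)
Require Import Defs.
From mathcomp Require Import all_boot all_order all_algebra.

Import Order.TTheory GRing.Theory Num.Theory.

(** Cut a minimum dominating set [D] into parts of [uphalf #|D|] and [#|D|./2]
    vertices. Their closed neighbourhoods cover the graph, so one of them covers
    at least half of the vertices. *)

(** Each part has at most [uphalf #|D|] vertices, so it does not matter which one covers half.
    [set_split] cuts [D], [closed_nbhd_setU] turns domination by [D] into a cover by two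
    neighbourhoods, and [p_dominating_half] makes the comparison one of natural numbers. *)

Lemma closed_nbhd_setT (V : finType) (e : rel V) :
  closed_nbhd_set e [set: V] = [set: V].
Proof.
apply/setP=> v; rewrite inE; apply/bigcupP; exists v => //.
by rewrite !inE eqxx.
Qed.

Lemma closed_nbhd_setU (V : finType) (e : rel V) (A B : {set V}) :
  closed_nbhd_set e (A :|: B) = closed_nbhd_set e A :|: closed_nbhd_set e B.
Proof. exact: bigcup_setU. Qed.

(** Clearing denominators needs [V] nonempty: division by zero yields 0, so on an empty [V] the left
    side is false and the right side true. *)
Lemma p_dominating_half (R : realFieldType) (V : finType) (e : rel V)
    (S : {set V}) : 0 < #|V| ->
  p_dominating (1 / 2 : R)%R e S = (#|V| <= (#|closed_nbhd_set e S|).*2).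
Proof.
move=> V_gt0; rewrite /p_dominating ler_pdivlMr ?ltr0n // mulrAC mul1r.
by rewrite ler_pdivrMr ?ltr0n // -natrM ler_nat muln2.
Qed.

Lemma domination_number_witness (V : finType) (e : rel V) :
  exists2 D : {set V}, dominating e D & #|D| = domination_number e.
Proof.
rewrite /domination_number; case: arg_minnP => [|D domD _]; last by exists D.
by rewrite /dominating closed_nbhd_setT.
Qed.

Lemma partial_domination_number_half_le (R : realFieldType) (V : finType)
    (e : rel V) (S : {set V}) : 0 < #|V| ->
  p_dominating (1 / 2 : R)%R e S ->
  partial_domination_number (1 / 2 : R)%R e <= #|S|.
Proof.
move=> V_gt0 domS; rewrite /partial_domination_number.
case: arg_minnP => [|T _ minT]; last exact: minT.
(* The default [[set: V]] of the arg min must itself be admissible. *)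
by rewrite p_dominating_half // closed_nbhd_setT cardsT -addnn leq_addr.
Qed.

Lemma set_split (T : finType) (D : {set T}) (k : nat) : k <= #|D| ->
  exists A B : {set T}, [/\ A :|: B = D, #|A| = k & #|B| = #|D| - k].
Proof.
move=> le_k; have uniqD := enum_uniq (mem D).
(* Cut the duplicate-free list [enum D] at position [k]. *)
exists [set x in take k (enum D)], [set x in drop k (enum D)]; split.
- by apply/setP=> x; rewrite !inE -mem_cat cat_take_drop mem_enum.
- by rewrite cardsE (card_uniqP _) ?take_uniq // size_takel // -cardE.
- by rewrite cardsE (card_uniqP _) ?drop_uniq // size_drop -cardE.
Qed.

(* uphalf n is the ceiling of n / 2. *)
Theorem theorem3p3 (R : realFieldType) (V : finType) (e : rel V)
    (simple_e : simple_graph e) (connected_e : connected_graph e) :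
  partial_domination_number (1 / 2 : R)%R e <= uphalf (domination_number e).
Proof.
have [V_gt0 _] := connected_e.
have [D domD <-] := domination_number_witness _ e.
have [|A [B [defD cardA cardB]]] := @set_split _ D (uphalf #|D|).
  by rewrite leq_uphalf_double -addnn leq_addr.
have cover : #|V| <= #|closed_nbhd_set e A| + #|closed_nbhd_set e B|.
  move: domD; rewrite /dominating -defD closed_nbhd_setU => /eqP coverV.
  by rewrite -cardsT -coverV cardsU leq_subr.
(* The larger of the two neighbourhoods, counted twice, is at least their sum, hence at least
   [#|V|]. *)
have [leBA | /ltnW leAB] :=
  leqP #|closed_nbhd_set e B| #|closed_nbhd_set e A|.
- rewrite -cardA; apply: partial_domination_number_half_le => //.
  rewrite p_dominating_half // -addnn; apply: leq_trans cover _.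
  by rewrite leq_add2l.
(* [B] is the floor half, so it too fits the bound. *)
- have leB : #|B| <= uphalf #|D|.
    by rewrite cardB leq_subLR addnn -leq_uphalf_double.
  apply: leq_trans leB; apply: partial_domination_number_half_le => //.
  rewrite p_dominating_half // -addnn; apply: leq_trans cover _.
  by rewrite leq_add2r.
Qed.
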